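(* Let $E_0$ be a set of ground equations between canonized terms. For any configuration $\langle E_n\mid R_n\rangle$ reachable from $\langle E_0\mid\emptyset\rangle$ by the inference rules of $\mathsf{AC}(\mathsf{X})$, and for all terms $s,t$ such that $s\approx t\in E_n$ or $s\rightarrow t\in R_n$, we have $s=_{AC,\mathsf{X},E_0}t$.
   Context: Signature and theories. $\Sigma=\Sigma_{AC}\uplus\Sigma_{\mathcal{E}}\uplus\Sigma_{\mathsf{X}}$: $\Sigma_{AC}$ binary associative-commutative symbols, $\Sigma_{\mathcal{E}}$ uninterpreted symbols, $\Sigma_{\mathsf{X}}$ the signature of a Shostak theory $\mathsf{X}$ with canonizer $\mathtt{can}_{\mathsf{X}}$ ($s=_{\mathsf{X}}t$ iff $\mathtt{can}_{\mathsf{X}}(s)=\mathtt{can}_{\mathsf{X}}(t)$) and solver $\mathtt{solve}_{\mathsf{X}}$ (returning $\bot$ on an equation between $\Sigma_{\mathsf{X}}$-terms inconsistent with $\mathsf{X}$, otherwise an equivalent substitution $\{x_i\approx t_i\}$). $AC$ is the set of equations $u(x,y)\approx u(y,x)$, $u(x,u(y,z))\approx u(u(x,y),z)$, $u\in\Sigma_{AC}$. $=_{AC,\mathsf{X},E_0}$ is the equational theory generated by $AC$, the axioms of $\mathsf{X}$ and $E_0$. Ordering. $\preceq$ is a total ground AC-reduction ordering: a well-founded quasi-ordering on terms stable under substitutions and contexts, total on ground terms, whose equivalence $\simeq$ coincides with $=_{AC}$; $\prec$ its strict part. Canonizer and solver. Fix a bijection $\alpha$ from ground terms to variables with inverse $\rho$;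 $[t]=f([s_1],\dots,[s_n])$ if $t=f(s_1,\dots,s_n)$, $f\in\Sigma_{\mathsf{X}}$, else $[t]=\alpha(t)$. $\mathtt{can}_{AC}$ is the identity on variables, commutes with symbols not in $\Sigma_{AC}$, and $\mathtt{can}_{AC}(u(t_1,t_2))=u(s_1,u(s_2,\dots,u(s_{n-1},s_n)\dots))$ where $\{s_1,\dots,s_n\}$ is the multiset union of the maximal non-$u$-rooted subterms (reached through $u$-nodes only) of $\mathtt{can}_{AC}(t_1)$ and $\mathtt{can}_{AC}(t_2)$, sorted by a fixed total ordering $\unlhd$. Global canonizer: $\mathtt{can}(x)=x$; $\mathtt{can}(f(\vec v))=f(\mathtt{can}(\vec v))$, $f\in\Sigma_{\mathcal{E}}$; $\mathtt{can}(u(s,t))=\mathtt{can}_{AC}(u(\mathtt{can}(s),\mathtt{can}(t)))$, $u\in\Sigma_{AC}$; $\mathtt{can}(f(\vec v))=\mathtt{can}_{\mathsf{X}}(f([\mathtt{can}(\vec v)]))\rho$, $f\in\Sigma_{\mathsf{X}}$. Wrapper: $\mathtt{solve}(s\approx t)=\bot$ if $\mathtt{solve}_{\mathsf{X}}([s]\approx[t])=\bot$, else $\{x_i\rho\rightarrow t_i\rho\}$ when $\mathtt{solve}_{\mathsf{X}}([s]\approx[t])=\{x_i\approx t_i\}$. Standing assumption (local compatibility): for all ground $t$, $\mathtt{can}_{\mathsf{X}}([t])\preceq[t]$, and if $\mathtt{solve}_{\mathsf{X}}([s]\approx[t])=\{x_i\approx t_i\}$ then $t_i\rho\prec x_i\rho$.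 Rewriting. $s\rightarrow^p_{AC\backslash l\rightarrow r}t$ iff either $s|_p=_{AC}l$ and $t=s[r]_p$, or $l$ has root $u\in\Sigma_{AC}$ and $s|_p=_{AC}u(l,s')$, $t=s[u(r,s')]_p$ for some $s'$. Canonized rewriting: $s\rightsquigarrow_{l\rightarrow r}t$ iff $s\rightarrow_{AC\backslash l\rightarrow r}t'$ at some position and $t=\mathtt{can}(t')$; $\rightsquigarrow_R$ is the union over rules of $R$. $\mathtt{headCP}(R)$ is the set of equations $u(b,r')\approx u(b',r)$ such that $l\rightarrow r$, $l'\rightarrow r'\in R$ and there is a term $a^\mu$, maximal w.r.t. size, with $l=_{AC}u(a^\mu,b)$ and $l'=_{AC}u(a^\mu,b')$, $u\in\Sigma_{AC}$. Rules of $\mathsf{AC}(\mathsf{X})$ on configurations $\langle E\mid R\rangle$: Trivial: $\langle E\cup\{s\approx t\}\mid R\rangle\Rightarrow\langle E\mid R\rangle$ if $s=t$. Bottom: $\langle E\cup\{s\approx t\}\mid R\rangle\Rightarrow\bot$ if $\mathtt{solve}(s\approx t)=\bot$. Orient: $\langle E\cup\{s\approx t\}\mid R\rangle\Rightarrow\langle E\mid R\cup\mathtt{solve}(s\approx t)\rangle$ if $\mathtt{solve}(s\approx t)\neq\bot$. Simplify: $\langle E\cup\{s\approx t\}\mid R\rangle\Rightarrow\langle E\cup\{s'\approx t\}\mid R\rangle$ if $s\rightsquigarrow_R s'$. Compose: $\langle E\mid R\cup\{l\rightarrow r\}\rangle\Rightarrow\langle E\mid R\cup\{l\rightarrow r'\}\rangle$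 if $r\rightsquigarrow_R r'$. Collapse: $\langle E\mid R\cup\{g\rightarrow d,l\rightarrow r\}\rangle\Rightarrow\langle E\cup\{l'\approx r\}\mid R\cup\{g\rightarrow d\}\rangle$ if $l\rightsquigarrow_{g\rightarrow d}l'$ and ($g\prec l$ or ($g\simeq l$ and $d\prec r$)). Deduce: $\langle E\mid R\rangle\Rightarrow\langle E\cup\{s\approx t\}\mid R\rangle$ if $s\approx t\in\mathtt{headCP}(R)$. Equations are unordered pairs. *)

(* Defs.v *)
From mathcomp Require Import all_boot boolp classical_sets.
From Stdlib Require List Relation_Operators.

Set Implicit Arguments.
Unset Strict Implicit.
Unset Printing Implicit Defensive.

Local Open Scope classical_set_scope.

(** The three pairwise disjoint parts of a signature; the symbols in [ACop]
    are binary. *)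
Record signature := Signature {
  ACop : eqType;
  Eop : Type;
  Earity : Eop -> nat;
  Xop : Type;
  Xarity : Xop -> nat }.

Inductive term (S : signature) (V : Type) : Type :=
| Var of V
| ATm (u : ACop S) of term S V & term S V
| ETm (f : Eop S) of {ffun 'I_(Earity f) -> term S V}
| XTm (f : Xop S) of {ffun 'I_(Xarity f) -> term S V}.

Arguments Var {S V} _.
Arguments ATm {S V} _ _ _.
Arguments ETm {S V} _ _.
Arguments XTm {S V} _ _.

(** An equation is an unordered pair of terms; [s ≈ s] is the singleton. *)
Definition equation (S : signature) (V : Type) := set (term S V).

Definition mk_equation S V (s t : term S V) : equation S V := [set s; t].

Notation "s ≈ t" := (mk_equation s t) (at level 70, no associativity).

Section Terms.
Context {S : signature} {V : Type}.
Notation term := (term S V).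
Notation equation := (equation S V).

Fixpoint ground (t : term) : Prop :=
  match t with
  | Var _ => False
  | ATm _ a b => ground a /\ ground b
  | ETm f v => forall i, ground (v i)
  | XTm f v => forall i, ground (v i)
  end.

(** Terms over the signature of [X] alone, with variables. *)
Fixpoint xterm (t : term) : Prop :=
  match t with
  | Var _ => True
  | ATm _ _ _ => False
  | ETm _ _ => False
  | XTm f v => forall i, xterm (v i)
  end.

Fixpoint tsize (t : term) : nat :=
  match t with
  | Var _ => 1
  | ATm _ a b => (tsize a + tsize b).+1
  | ETm f v => (\sum_i tsize (v i)).+1
  | XTm f v => (\sum_i tsize (v i)).+1
  end.

Fixpoint subst (sigma : V -> term) (t : term) : term :=
  match t with
  | Var x => sigma x
  | ATm u a b => ATm u (subst sigma a) (subst sigma b)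
  | ETm f v => ETm f [ffun i => subst sigma (v i)]
  | XTm f v => XTm f [ffun i => subst sigma (v i)]
  end.

(** Positions are words of argument indices, numbered from 0. *)
Fixpoint subterm_at (s : term) (p : seq nat) : option term :=
  if p is i :: q then
    match s with
    | Var _ => None
    | ATm _ a b => match i with
                   | 0 => subterm_at a q
                   | 1 => subterm_at b q
                   | _ => None
                   end
    | ETm f v => if insub i is Some j then subterm_at (v j) q else None
    | XTm f v => if insub i is Some j then subterm_at (v j) q else None
    end
  else Some s.

(** [s] itself is returned when [p] is not a position of [s]. *)
Fixpoint replace_at (s : term) (p : seq nat) (r : term) : term :=
  if p is i :: q then
    match s with
    | Var x => Var x
    | ATm u a b => match i with
                   | 0 => ATm u (replace_at a q r) b
                   | 1 => ATm u a (replace_at b q r)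
                   | _ => ATm u a b
                   end
    | ETm f v => ETm f [ffun j : 'I_(Earity f) =>
                          if val j == i then replace_at (v j) q r else v j]
    | XTm f v => XTm f [ffun j : 'I_(Xarity f) =>
                          if val j == i then replace_at (v j) q r else v j]
    end
  else r.

(** [eqth A E] is the congruence generated by all the instances of the
    equations in [A] and by the equations in [E] themselves: the variables
    that occur in [E] are treated as constants. *)
Inductive eqth (A E : set equation) : term -> term -> Prop :=
| eqth_inst s t sigma : A (s ≈ t) -> eqth A E (subst sigma s) (subst sigma t)
| eqth_hyp s t : E (s ≈ t) -> eqth A E s t
| eqth_refl s : eqth A E s s
| eqth_sym s t : eqth A E s t -> eqth A E t s
| eqth_trans s t r : eqth A E s t -> eqth A E t r -> eqth A E s r
| eqth_AC u a a' b b' :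
    eqth A E a a' -> eqth A E b b' -> eqth A E (ATm u a b) (ATm u a' b')
| eqth_E f (v w : {ffun 'I_(Earity f) -> term}) :
    (forall i, eqth A E (v i) (w i)) -> eqth A E (ETm f v) (ETm f w)
| eqth_X f (v w : {ffun 'I_(Xarity f) -> term}) :
    (forall i, eqth A E (v i) (w i)) -> eqth A E (XTm f v) (XTm f w).

Definition AC_axioms : set equation :=
  [set e | exists (u : ACop S) (x y z : V),
      e = (ATm u (Var x) (Var y) ≈ ATm u (Var y) (Var x)) \/
      e = (ATm u (Var x) (ATm u (Var y) (Var z))
             ≈ ATm u (ATm u (Var x) (Var y)) (Var z))].

Definition eqAC : term -> term -> Prop := eqth AC_axioms set0.

Definition is_axiomatization (X : set equation) : Prop :=
  forall e, X e -> exists s t, [/\ xterm s, xterm t & e = (s ≈ t)].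

(** The second clause says that [canX t] is a normal form of [t], i.e. a
    representative of the class of [t]; the third one alone would allow [canX]
    to send a class to a member of another class. *)
Definition is_canonizer (X : set equation) (canX : term -> term) : Prop :=
  [/\ forall t, xterm t -> xterm (canX t),
      forall t, xterm t -> eqth X set0 (canX t) t
    & forall s t, xterm s -> xterm t ->
        (eqth X set0 s t <-> canX s = canX t)].

Definition inconsistent (X : set equation) (e : equation) : Prop :=
  forall a b, xterm a -> xterm b -> eqth X [set e] a b.

Definition equations_of (sigma : seq (V * term)) : set equation :=
  [set e | exists x t, List.In (x, t) sigma /\ e = (Var x ≈ t)].

(** Quasi-ordering [le], with strict part [lt_of le]. *)
Definition lt_of (le : term -> term -> Prop) (s t : term) : Prop :=
  le s t /\ ~ le t s.

Record total_ground_AC_reduction_ordering (le : term -> term -> Prop) : Prop := {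
  _ : forall s, le s s;
  _ : forall s t r, le s t -> le t r -> le s r;
  _ : well_founded (lt_of le);
  _ : forall sigma s t, le s t -> le (subst sigma s) (subst sigma t);
  _ : forall c p s t, le s t -> le (replace_at c p s) (replace_at c p t);
  _ : forall s t, ground s -> ground t -> le s t \/ le t s;
  _ : forall s t, le s t /\ le t s <-> eqAC s t }.

Definition is_abstraction (alpha : term -> V) (rho : V -> term) : Prop :=
  [/\ forall x, ground (rho x),
      forall x, alpha (rho x) = x
    & forall t, ground t -> rho (alpha t) = t].

Definition total_ordering (leT : rel term) : Prop :=
  [/\ reflexive leT, transitive leT, antisymmetric leT & total leT].

(** The maximal non-[u]-rooted subterms of [t] reached through [u]-nodes. *)
Fixpoint flatten_AC (u : ACop S) (t : term) : seq term :=
  match t with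
  | ATm v a b => if v == u then flatten_AC u a ++ flatten_AC u b else [:: t]
  | _ => [:: t]
  end.

(** [u(s1, u(s2, ... u(s(n-1), sn)))] for [s1 :: [:: s2; ...; sn]]. *)
Fixpoint comb_AC (u : ACop S) (s1 : term) (ss : seq term) : term :=
  if ss is s2 :: ss' then ATm u s1 (comb_AC u s2 ss') else s1.

(** The list that is sorted is never empty. *)
Fixpoint can_AC (leT : rel term) (t : term) : term :=
  match t with
  | Var x => Var x
  | ATm u t1 t2 =>
      match sort leT (flatten_AC u (can_AC leT t1)
                        ++ flatten_AC u (can_AC leT t2)) with
      | s1 :: ss => comb_AC u s1 ss
      | [::] => ATm u t1 t2
      end
  | ETm f v => ETm f [ffun i => can_AC leT (v i)]
  | XTm f v => XTm f [ffun i => can_AC leT (v i)]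
  end.

(** [abs alpha t] is [[t]]. *)
Fixpoint abs (alpha : term -> V) (t : term) : term :=
  match t with
  | XTm f v => XTm f [ffun i => abs alpha (v i)]
  | _ => Var (alpha t)
  end.

End Terms.

(** Repeated variables are excluded: [sigma] is a substitution.  The equation
    and the conjunction of [x ≈ t], for [(x, t)] in [sigma], are equivalent
    modulo [X] when they have the same consequences modulo [X]. *)
Definition is_solver (S : signature) (V : eqType) (X : set (equation S V))
    (solveX : equation S V -> option (seq (V * term S V))) : Prop :=
  forall s t, xterm s -> xterm t ->
    match solveX (s ≈ t) with
    | None => inconsistent X (s ≈ t)
    | Some sigma =>
        [/\ ~ inconsistent X (s ≈ t),
            uniq (unzip1 sigma),
            forall x r, List.In (x, r) sigma -> xterm r
          & forall a b, xterm a -> xterm b ->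
              (eqth X [set s ≈ t] a b <-> eqth X (equations_of sigma) a b)]
    end.

Inductive config (S : signature) (V : Type) : Type :=
| Config (E : set (equation S V)) (R : set (term S V * term S V))
| Bot.

Arguments Bot {S V}.

Section ACX.
Context {S : signature} {V : Type}.
Notation term := (term S V).
Notation equation := (equation S V).
Variables (canX : term -> term).
Variables (solveX : equation -> option (seq (V * term))).
Variables (leT : rel term).
Variables (alpha : term -> V) (rho : V -> term).
Variable (le : term -> term -> Prop).

Fixpoint can (t : term) : term :=
  match t with
  | Var x => Var x
  | ETm f v => ETm f [ffun i => can (v i)]
  | ATm u a b => can_AC leT (ATm u (can a) (can b))
  | XTm f v => subst rho (canX (XTm f [ffun i => abs alpha (can (v i))]))
  end.

(** [None] stands for bottom; the value is the list of the rules
    [x rho -> t rho]. *)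
Definition solve (s t : term) : option (seq (term * term)) :=
  omap (map (fun xt => (rho xt.1, subst rho xt.2)))
       (solveX (abs alpha s ≈ abs alpha t)).

Definition canonized (t : term) : Prop := exists2 t', ground t' & t = can t'.

(** Both clauses are comparisons of ground terms.  In the first one, comparing
    the open terms [canX (abs alpha t)] and [abs alpha t] would be a stronger
    demand (apply [rho] and stability); as [le] is stable under exchanging two
    variables, it could not hold for a commutative symbol of [X].  In the
    second one, [s] and [t] are canonized: for the distinct AC-equal terms
    [u(a, b)] and [u(b, a)], whose images by [alpha] are distinct variables,
    a strict inequality is impossible. *)
Definition locally_compatible : Prop :=
  (forall t, ground t ->
     le (subst rho (canX (abs alpha t))) (subst rho (abs alpha t))) /\
  (forall s t sigma, canonized s -> canonized t ->
     solveX (abs alpha s ≈ abs alpha t) = Some sigma ->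
     forall x r, List.In (x, r) sigma -> lt_of le (subst rho r) (rho x)).

Definition AC_rewrite_at (p : seq nat) (l r s t : term) : Prop :=
  exists2 s0, subterm_at s p = Some s0 &
    (eqAC s0 l /\ t = replace_at s p r) \/
    (exists (u : ACop S) (l1 l2 s' : term),
       [/\ l = ATm u l1 l2,
           eqAC s0 (ATm u l s')
         & t = replace_at s p (ATm u r s')]).

Definition can_rewrite (l r s t : term) : Prop :=
  exists p t', AC_rewrite_at p l r s t' /\ t = can t'.

Definition can_rewrites (R : set (term * term)) (s t : term) : Prop :=
  exists l r, R (l, r) /\ can_rewrite l r s t.

Definition headCP (R : set (term * term)) : set equation :=
  [set e | exists (u : ACop S) (l r l' r' a b b' : term),
      [/\ R (l, r), R (l', r'),
          eqAC l (ATm u a b) /\ eqAC l' (ATm u a b'),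
          (forall c d d', eqAC l (ATm u c d) -> eqAC l' (ATm u c d') ->
             tsize c <= tsize a)
        & e = (ATm u b r' ≈ ATm u b' r)]].

(** The unions are not required to be disjoint. *)
Inductive step : config S V -> config S V -> Prop :=
| Trivial E R s t :
    s = t ->
    step (Config (E `|` [set s ≈ t]) R) (Config E R)
| Bottom E R s t :
    solve s t = None ->
    step (Config (E `|` [set s ≈ t]) R) Bot
| Orient E R s t rules :
    solve s t = Some rules ->
    step (Config (E `|` [set s ≈ t]) R)
         (Config E (R `|` [set lr | List.In lr rules]))
| Simplify E R s s' t :
    can_rewrites R s s' ->
    step (Config (E `|` [set s ≈ t]) R) (Config (E `|` [set s' ≈ t]) R)
| Compose E R l r r' :
    can_rewrites R r r' ->
    step (Config E (R `|` [set (l, r)])) (Config E (R `|` [set (l, r')]))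
| Collapse E R g d l r l' :
    can_rewrite g d l l' ->
    lt_of le g l \/ ((le g l /\ le l g) /\ lt_of le d r) ->
    step (Config E (R `|` [set (g, d); (l, r)]))
         (Config (E `|` [set l' ≈ r]) (R `|` [set (g, d)]))
| Deduce E R s t :
    headCP R (s ≈ t) ->
    step (Config E R) (Config (E `|` [set s ≈ t]) R).

Definition reachable : config S V -> config S V -> Prop :=
  Relation_Operators.clos_refl_trans _ step.

Definition ground_canonized_equations (E : set equation) : Prop :=
  forall e, E e -> exists s t,
    [/\ ground s, ground t, canonized s, canonized t & e = (s ≈ t)].

End ACX.

(* Main.v *)
(** Every inference rule only adds consequences of what is already present.
    Two points need care.  The variables that abstract alien subterms are
    opened again by [rho], which inverts [alpha] only on ground terms; so
    groundness has to be carried along, and it survives because the [AC]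
    axioms are regular.  And the [AC] axioms have all their instances only if
    there are three distinct variables; there are, since variables are in
    bijection with ground terms and an [AC] symbol produces infinitely many
    of those. *)
Require Import Defs.
From HB Require Import structures.
From mathcomp Require Import all_boot boolp classical_sets.
From Stdlib Require List.

Set Implicit Arguments.
Unset Strict Implicit.
Unset Printing Implicit Defensive.

Local Open Scope classical_set_scope.

(** * Equational reasoning, replacement and groundness *)

HB.instance Definition _ (S : signature) (V : Type) := gen_eqMixin (term S V).

Section Equational.
Context {S : signature} {V : Type}.
Notation term := (term S V).
Implicit Types (s t : term) (A E : set (equation S V)) (sigma : V -> term).

(** Written by hand to get induction hypotheses for the arguments stored in finite functions. *)
Fixpoint term_nested_ind (P : term -> Prop)
    (Pvar : forall x, P (Var x))
    (PA : forall u a b, P a -> P b -> P (ATm u a b))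
    (PE : forall f (v : {ffun 'I_(Earity f) -> term}),
      (forall i, P (v i)) -> P (ETm f v))
    (PX : forall f (v : {ffun 'I_(Xarity f) -> term}),
      (forall i, P (v i)) -> P (XTm f v))
    (t : term) : P t :=
  let rec := term_nested_ind Pvar PA PE PX in
  match t with
  | Var x => Pvar x
  | ATm u a b => PA u a b (rec a) (rec b)
  | ETm f v => PE f v (fun i => rec (v i))
  | XTm f v => PX f v (fun i => rec (v i))
  end.

(** Equations are sets, so their equality is extensional; the four memberships also settle
    degenerate pairs such as [s ≈ s]. *)
Lemma mk_equation_inj s t s' t' :
  (s ≈ t) = (s' ≈ t') -> (s = s' /\ t = t') \/ (s = t' /\ t = s').
Proof.
move=> e.
have P (x : term) : (x = s \/ x = t) <-> (x = s' \/ x = t').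
  by move/(congr1 (@^~ x)): e; rewrite /mk_equation /= => ->.
have [s1 t1] := ((P s).1 (or_introl erefl), (P t).1 (or_intror erefl)).
have [s2 t2] := ((P s').2 (or_introl erefl), (P t').2 (or_intror erefl)).
by case: s1 t1 s2 t2 => ? [] ? [] ? [] ?; subst; auto.
Qed.

Lemma subst_comp sigma tau t :
  subst tau (subst sigma t) = subst (subst tau \o sigma) t.
Proof.
elim/term_nested_ind: t => [//|u a b /= -> -> //|f v IH|f v IH] /=.
- by congr ETm; apply/ffunP => i; rewrite !ffunE IH.
- by congr XTm; apply/ffunP => i; rewrite !ffunE IH.
Qed.

Lemma eqth_mono A A' E E' s t :
  A `<=` A' -> E `<=` E' -> eqth A E s t -> eqth A' E' s t.
Proof.
move=> AA' EE'; elim.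
- by move=> *; apply/eqth_inst/AA'.
- by move=> *; apply/eqth_hyp/EE'.
- exact: eqth_refl.
- by move=> *; apply: eqth_sym.
- by move=> ? ? ? _ IH _ IH'; apply: eqth_trans IH IH'.
- by move=> *; apply: eqth_AC.
- by move=> *; apply: eqth_E.
- by move=> *; apply: eqth_X.
Qed.

(** Instances of [A] compose with [sigma], whereas variables of [E] are constants, so the images of
    [E] must be derived separately. With [sigma := rho] this carries consequences of [X] from
    abstracted terms back to ground terms. *)
Lemma eqth_subst A A' E E' sigma s t :
  A `<=` A' ->
  (forall a b, E (a ≈ b) -> eqth A' E' (subst sigma a) (subst sigma b)) ->
  eqth A E s t -> eqth A' E' (subst sigma s) (subst sigma t).
Proof.
move=> AA' EE'; elim => {s t}.
- by move=> s t tau /AA' st; rewrite !subst_comp; apply: eqth_inst.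
- exact: EE'.
- by move=> *; apply: eqth_refl.
- by move=> *; apply: eqth_sym.
- by move=> ? ? ? _ IH _ IH'; apply: eqth_trans IH IH'.
- by move=> *; apply: eqth_AC.
- by move=> f v w _ IH; apply: eqth_E => i; rewrite !ffunE.
- by move=> f v w _ IH; apply: eqth_X => i; rewrite !ffunE.
Qed.

Lemma subterm_at_nil s : subterm_at s [::] = Some s.
Proof. by case: s. Qed.

Lemma replace_at_nil s r : replace_at s [::] r = r.
Proof. by case: s. Qed.

Lemma eqth_replace_at A E s p s0 r :
  subterm_at s p = Some s0 -> eqth A E s0 r -> eqth A E s (replace_at s p r).
Proof.
move=> + s0r; elim: p s => [s|i p IH [x|u a b|f v|f v]] //=.
- by rewrite subterm_at_nil replace_at_nil => -[->].
- case: i => [|[|//]] /IH sr; apply: eqth_AC => //; exact: eqth_refl.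
- case: insubP => // j _ <- /IH sr; apply: eqth_E => k; rewrite ffunE.
  by case: ifP => [/eqP/val_inj -> //|_]; apply: eqth_refl.
- case: insubP => // j _ <- /IH sr; apply: eqth_X => k; rewrite ffunE.
  by case: ifP => [/eqP/val_inj -> //|_]; apply: eqth_refl.
Qed.

Lemma ground_subterm_at s p s0 :
  ground s -> subterm_at s p = Some s0 -> ground s0.
Proof.
elim: p s => [s gs|i p IH [x|u a b|f v|f v]] //=.
- by rewrite subterm_at_nil => -[<-].
- by case: i => [|[|//]] [] ga gb /IH; apply.
- by move=> gv; case: insubP => // j _ _ /IH; apply.
- by move=> gv; case: insubP => // j _ _ /IH; apply.
Qed.

Lemma ground_replace_at s p r :
  ground s -> ground r -> ground (replace_at s p r).
Proof.
move=> + gr; elim: p s => [s _|i p IH [x|u a b|f v|f v]] //=.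
- by rewrite replace_at_nil.
- by case: i => [|[|//]] [] ga gb /=; split => //; apply: IH.
- by move=> gv j; rewrite ffunE; case: ifP => // _; apply: IH.
- by move=> gv j; rewrite ffunE; case: ifP => // _; apply: IH.
Qed.

Lemma ground_subst sigma t : (forall x, ground (sigma x)) -> ground (subst sigma t).
Proof.
move=> gs; elim/term_nested_ind: t => //= f v IH i; rewrite ffunE; exact: IH.
Qed.

(** Both sides of each AC axiom have the same variables, so an instance is ground on one side iff it
    is on the other. An axiom of [X] may drop variables. *)
Lemma eqAC_ground s t : eqAC s t -> (ground s <-> ground t).
Proof.
elim => {s t} //=.
- move=> s t sigma [u [x [y [z [|]]]]] /mk_equation_inj [] [-> ->] /=; tauto.
- by move=> *; tauto.
- by move=> *; tauto.
- by move=> *; tauto.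
- by move=> f v w _ IH; split=> g i; apply/IH.
- by move=> f v w _ IH; split=> g i; apply/IH.
Qed.

End Equational.

Arguments term_nested_ind [S V].

(** * AC reasoning, and correctness of [can_AC] *)

Section Abstraction.
Context {S : signature} {V : eqType}.
Notation term := (term S V).
Context (alpha : term -> V) (rho : V -> term).
Context (halpha : is_abstraction alpha rho).
Implicit Types (s t : term) (A E : set (equation S V)).

(** The ground terms [g], [u(g, g)], [u(g, u(g, g))] have different sizes, and [alpha] is injective
    on ground terms. The term [t] only provides an inhabitant of [V]. *)
Lemma ACop_three_variables (u : ACop S) t :
  exists x y z : V, [/\ x != y, x != z & y != z].
Proof.
have [grho _ alphaK] := halpha.
pose g := rho (alpha t); pose gg := ATm u g g; pose ggg := ATm u g gg.
have gP : ground g by exact: grho.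
have alphaI (a b : term) : ground a -> ground b -> Defs.tsize a != Defs.tsize b ->
    alpha a != alpha b.
  move=> ga gb; apply: contra_neq => /(congr1 rho).
  by rewrite !alphaK // => ->.
exists (alpha g), (alpha gg), (alpha ggg); split; apply: alphaI => //=.
- by rewrite ltn_eqF // ltnS leq_addr.
- by rewrite ltn_eqF // ltnS leq_addr.
- by rewrite eqSS eqn_add2l ltn_eqF // ltnS leq_addr.
Qed.

(** The axiom has to be taken at distinct variables: otherwise [sigma] would send both to the same
    term. *)
Lemma eqAC_comm (u : ACop S) a b : @eqAC S V (ATm u a b) (ATm u b a).
Proof.
have [x [y [z [xy _ _]]]] := ACop_three_variables u a.
pose sigma v := if v == x then a else b.
suff: eqAC (subst sigma (ATm u (Var x) (Var y)))
           (subst sigma (ATm u (Var y) (Var x))).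
  by rewrite /= /sigma eqxx eq_sym (negPf xy).
by apply: eqth_inst; exists u, x, y, z; left.
Qed.

Lemma eqAC_assoc (u : ACop S) a b c :
  @eqAC S V (ATm u a (ATm u b c)) (ATm u (ATm u a b) c).
Proof.
have [x [y [z [xy xz yz]]]] := ACop_three_variables u a.
pose sigma v := if v == x then a else if v == y then b else c.
suff: eqAC (subst sigma (ATm u (Var x) (ATm u (Var y) (Var z))))
           (subst sigma (ATm u (ATm u (Var x) (Var y)) (Var z))).
  rewrite /= /sigma !eqxx (eq_sym y) (eq_sym z x) (eq_sym z y).
  by rewrite (negPf xy) (negPf xz) (negPf yz).
by apply: eqth_inst; exists u, x, y, z; right.
Qed.

Lemma eqAC_left_comm (u : ACop S) a b c :
  @eqAC S V (ATm u a (ATm u b c)) (ATm u b (ATm u a c)).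
Proof.
apply: eqth_trans (eqAC_assoc u a b c) _.
apply: eqth_trans (eqth_sym (eqAC_assoc u b a c)).
apply: eqth_AC (eqth_refl _ _ _); exact: eqAC_comm.
Qed.

Lemma comb_AC_cat (u : ACop S) (x y : term) (s r : seq term) :
  eqAC (comb_AC u x (s ++ y :: r)) (ATm u (comb_AC u x s) (comb_AC u y r)).
Proof.
elim: s x => [|z s IH] x /=; first exact: eqth_refl.
apply: eqth_trans (eqAC_assoc _ _ _ _).
by apply: eqth_AC (IH z); apply: eqth_refl.
Qed.

(** Left commutations bring [x] to the front. If [x] is the last entry, nothing follows it and the
    first exchange is plain commutativity. *)
Lemma comb_AC_rem (u : ACop S) (x y : term) r : x \in r ->
  eqAC (comb_AC u y r) (ATm u x (comb_AC u y (rem x r))).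
Proof.
elim: r y => // w r IH y; rewrite inE /= eq_sym.
case: eqVneq => [-> _|_ /= /IH xr].
  by case: r {IH} => [|z r]; [apply: eqAC_comm|apply: eqAC_left_comm].
apply: eqth_trans (eqAC_left_comm _ _ _ _).
by apply: eqth_AC (xr w); apply: eqth_refl.
Qed.

(** Equal heads cancel. Otherwise [x] occurs in [r]; moving it to the front aligns the heads, and
    what remains are again permutations. *)
Lemma comb_AC_perm (u : ACop S) (x y : term) (s r : seq term) :
  perm_eq (x :: s) (y :: r) -> eqAC (comb_AC u x s) (comb_AC u y r).
Proof.
elim: s x y r => [|z s IH] x y r xyr.
  case: r xyr => [|w r] xyr; last by have := perm_size xyr.
  have := perm_mem xyr x; rewrite mem_head inE => /esym/eqP ->.
  exact: eqth_refl.
have xr := perm_mem xyr x; move: xr; rewrite mem_head inE.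
case: (eqVneq x y) => [xy _|nxy /= xr].
  move: xyr; rewrite -{}xy perm_cons; case: r => [|w r].
    by move/perm_size.
  by move/IH=> /= zr; apply: eqth_AC zr; apply: eqth_refl.
apply: eqth_trans (eqth_sym (comb_AC_rem u y (esym xr))).
apply: (eqth_AC _ (eqth_refl _ _ _)); apply: IH.
(* Consing [x] on both sides turns the goal into [y :: r] against [x :: y :: rem x r]. *)
rewrite -(perm_cons x) (permPl xyr) perm_sym.
by rewrite (perm_catCA [:: x] [:: y]) /= perm_cons perm_sym perm_to_rem.
Qed.

(** Nonemptiness is part of the conclusion because [comb_AC] takes its head separately. *)
Lemma comb_AC_flatten (u : ACop S) t :
  exists x (s : seq term), flatten_AC u t = x :: s /\ eqAC (comb_AC u x s) t.
Proof.
elim/term_nested_ind: t => [x|v a b [x [s [ea xa]]] [y [r [eb yb]]]|f v _|f v _].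
- by exists (Var x), [::]; split; last exact: eqth_refl.
- rewrite /=; case: eqVneq => [->|_].
    exists x, (s ++ y :: r); rewrite ea eb; split=> //.
    by apply: eqth_trans (comb_AC_cat _ _ _ _ _) _; apply: eqth_AC.
  by exists (ATm v a b), [::]; split; last exact: eqth_refl.
- by exists (ETm f v), [::]; split; last exact: eqth_refl.
- by exists (XTm f v), [::]; split; last exact: eqth_refl.
Qed.

Lemma can_AC_eqAC leT t : eqAC (can_AC leT t) t.
Proof.
elim/term_nested_ind: t => [x|u a b IHa IHb|f v IH|f v IH].
- exact: eqth_refl.
- set a' := can_AC leT a in IHa; set b' := can_AC leT b in IHb.
  have [x [s [eab xab]]] := comb_AC_flatten u (ATm u a' b').
  rewrite /= -/a' -/b'; move: eab; rewrite /= eqxx => ->.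
  have : perm_eq (sort leT (x :: s)) (x :: s) by rewrite perm_sort.
  (* Sorting preserves length, which rules out the default branch of [can_AC]. *)
  case: (sort leT _) => [/perm_size //|y r] /(comb_AC_perm u) yx.
  by apply: eqth_trans yx _; apply: eqth_trans xab _; apply: eqth_AC.
- by apply: eqth_E => i; rewrite !ffunE; apply: IH.
- by apply: eqth_X => i; rewrite !ffunE; apply: IH.
Qed.

Lemma subst_abs t : ground t -> subst rho (abs alpha t) = t.
Proof.
have [_ _ alphaK] := halpha.
elim/term_nested_ind: t => [//|u a b _ _|f v _|f v IH] gt; rewrite /= ?alphaK //.
by congr XTm; apply/ffunP => i; rewrite !ffunE IH.
Qed.

Lemma xterm_abs t : xterm (abs alpha t).
Proof. by elim/term_nested_ind: t => //= f v IH i; rewrite ffunE. Qed.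

(** * Soundness of the canonizer, rewriting and the solver *)

Section Theory.
Context (X : set (equation S V)) (E0 : set (equation S V)).
Context (canX : term -> term) (leT : rel term).
Context (hcanX : is_canonizer X canX).
Local Notation can := (can canX leT alpha rho).
Local Notation eqT := (eqth (AC_axioms `|` X) E0).

Lemma eqAC_eqT s t : eqAC s t -> eqT s t.
Proof. by apply: eqth_mono => //; apply: subsetUl. Qed.

(** Both claims go through one induction: under a symbol of [X], [rho] undoes the abstraction of the
    canonized arguments only once these are known to be ground. *)
Lemma can_ground_eqT t : ground t -> ground (can t) /\ eqT (can t) t.
Proof.
have [grho _ _] := halpha; have [_ canX_eq _] := hcanX.
elim/term_nested_ind: t => [//|u a b IHa IHb|f v IH|f v IH] /=.
- move=> [/IHa [ga ea] /IHb [gb eb]].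
  have cab := can_AC_eqAC leT (ATm u (can a) (can b)).
  split; first exact/(eqAC_ground cab).
  by apply: eqth_trans (eqAC_eqT cab) _; apply: eqth_AC.
- move=> gv; split=> [i|]; first by rewrite ffunE; have [] := IH i (gv i).
  by apply: eqth_E => i; rewrite ffunE; have [] := IH i (gv i).
- move=> gv; split; first exact: ground_subst.
  set w := XTm f _; have xw : xterm w by move=> i; rewrite ffunE; apply: xterm_abs.
  (* The midpoint is the image under [rho] of [canX w =_X w]; its right side has the canonized
     arguments. *)
  apply: (@eqth_trans _ _ _ _ _ (subst rho w)).
    by apply: eqth_subst (canX_eq w xw) => //; apply: subsetUr.
  rewrite /w /=; apply: eqth_X => i; rewrite !ffunE; have [gc ec] := IH i (gv i).
  by rewrite subst_abs.
Qed.

Definition entailed s t := [/\ ground s, ground t & eqT s t].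

Lemma entailed_sym s t : entailed s t -> entailed t s.
Proof. by move=> [gs gt st]; split=> //; apply: eqth_sym. Qed.

Lemma entailed_trans r s t : entailed r s -> entailed s t -> entailed r t.
Proof. by move=> [gr _ rs] [_ gt st]; split=> //; apply: eqth_trans st. Qed.

Lemma entailed_can t : ground t -> entailed t (can t).
Proof. by move=> gt; have [? ?] := can_ground_eqT gt; split=> //; apply: eqth_sym. Qed.

Lemma AC_rewrite_entailed p l r s t :
  entailed l r -> ground s -> AC_rewrite_at p l r s t -> entailed s t.
Proof.
move=> [gl gr lr] gs [s0 sp [[s0l ->]|[u [l1 [l2 [s' [el s0l ->]]]]]]].
- split=> //; first exact: ground_replace_at.
  by apply: eqth_replace_at sp _; apply: eqth_trans (eqAC_eqT s0l) lr.
(* The context [s'] is chosen only up to AC; it is ground because [u(l, s')] is AC-equal to a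
   subterm of [s]. *)
- have [_ gs'] := (eqAC_ground s0l).1 (ground_subterm_at gs sp).
  split=> //; first exact: ground_replace_at.
  apply: eqth_replace_at sp _; apply: eqth_trans (eqAC_eqT s0l) _.
  by apply: eqth_AC => //; apply: eqth_refl.
Qed.

Lemma can_rewrite_entailed l r s t :
  entailed l r -> ground s -> can_rewrite canX leT alpha rho l r s t ->
  entailed s t.
Proof.
move=> lr gs [p [t' [/(AC_rewrite_entailed lr gs) st' ->]]].
by apply: entailed_trans (st') (entailed_can _); case: st'.
Qed.

(** Both sides come from the overlap [u(a, u(b, b'))]: replacing [u(a, b')] by [r'] gives one,
    replacing [u(a, b)] by [r] the other. *)
Lemma headCP_entailed (R : set (term * term)) s t :
  (forall l r, R (l, r) -> entailed l r) -> headCP R (s ≈ t) -> entailed s t.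
Proof.
move=> hR [u [l [r [l' [r' [a [b [b' [Rlr Rlr' [el el'] _ est]]]]]]]]].
suff h : entailed (ATm u b r') (ATm u b' r).
  by case: (mk_equation_inj est) => [] [-> ->] //; apply: entailed_sym.
have [gl gr lr] := hR _ _ Rlr; have [gl' gr' lr'] := hR _ _ Rlr'.
have [[_ gb] [_ gb']] := ((eqAC_ground el).1 gl, (eqAC_ground el').1 gl').
split=> //.
have br' : eqT (ATm u b r') (ATm u b (ATm u a b')).
  apply: eqth_AC (eqth_refl _ _ _) _.
  exact: eqth_trans (eqth_sym lr') (eqAC_eqT el').
have b'r : eqT (ATm u b' (ATm u a b)) (ATm u b' r).
  apply: eqth_AC (eqth_refl _ _ _) _.
  exact: eqth_trans (eqth_sym (eqAC_eqT el)) lr.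
apply: eqth_trans br' _; apply: eqth_trans b'r; apply: eqAC_eqT.
apply: eqth_trans (eqAC_left_comm _ _ _ _) _.
apply: eqth_trans (eqAC_left_comm _ _ _ _).
exact: eqth_AC (eqth_refl _ _ _) (eqAC_comm _ _ _).
Qed.

Context (solveX : equation S V -> option (seq (V * term))).
Context (hsolveX : is_solver X solveX).

(** Each solved equation [x ≈ w] follows modulo [X] from the abstracted equation; applying [rho]
    turns the latter back into [s ≈ t] and the former into the rule. *)
Lemma solve_entailed s t rules l r :
  entailed s t -> solve solveX alpha rho s t = Some rules ->
  List.In (l, r) rules -> entailed l r.
Proof.
have [grho _ _] := halpha; move=> [gs gt st].
have := hsolveX (xterm_abs s) (xterm_abs t); rewrite /solve.
case: solveX => //= sigma [_ _ xsigma equiv] [<-].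
move=> /List.in_map_iff [[x w] [[<- <-] xw]].
split=> //=; first exact: ground_subst.
have xwE : eqth X [set abs alpha s ≈ abs alpha t] (Var x) w.
  apply/equiv => //; first exact: xsigma xw.
  by apply: eqth_hyp; exists x, w.
apply: (eqth_subst _ _ xwE) => [|a b /= /mk_equation_inj].
  exact: subsetUr.
by case=> [] [-> ->]; rewrite !subst_abs //; apply: eqth_sym.
Qed.

(** * The invariant along derivations *)

Definition entailed_config (c : config S V) : Prop :=
  if c is Config E R then
    (forall s t, E (s ≈ t) -> entailed s t) /\
    (forall l r, R (l, r) -> entailed l r)
  else True.

Lemma entailed_setU1 (E : set (equation S V)) s t :
  (forall a b, (E `|` [set s ≈ t]) (a ≈ b) -> entailed a b) <->
  (forall a b, E (a ≈ b) -> entailed a b) /\ entailed s t.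
Proof.
split=> [h|[hE st] a b [/hE //|/= /mk_equation_inj []] [-> ->] //].
  by split=> [a b ?|]; apply: h; [left|right].
exact: entailed_sym.
Qed.

Lemma step_entailed le c c' :
  step canX solveX leT alpha rho le c c' ->
  entailed_config c -> entailed_config c'.
Proof.
case=> //=.
- by move=> E R s t _ [/entailed_setU1 []].
- move=> E R s t rules srt [/entailed_setU1 [hE st] hR]; split=> // l r.
  by move=> [/hR //|/=]; apply: solve_entailed srt.
- move=> E R s s' t [l [r [/[dup] Rlr + ss']]] [/entailed_setU1 [hE st] hR].
  move=> /hR lr; split=> //; apply/entailed_setU1; split=> //.
  apply: entailed_trans (st); apply: entailed_sym.
  by apply: can_rewrite_entailed ss' => //; case: st.
- move=> E R l r r' [g [d [Rgd rr']]] [hE hR]; split=> // a b [Rab|[-> ->]].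
    by apply: hR; left.
  have lr : entailed l r by apply: hR; right.
  apply: entailed_trans (lr) _.
  by apply: can_rewrite_entailed rr'; [apply: hR; left|case: lr].
- move=> E R g d l r l' ll' _ [hE hR].
  have gd : entailed g d by apply: hR; right; left.
  have lr : entailed l r by apply: hR; right; right.
  split=> [|a b [Rab|[-> ->]] //]; last by apply: hR; left.
  (* The new equation closes the path from [l'] back to [l] and on to [r]. *)
  apply/entailed_setU1; split=> //; apply: entailed_trans (lr).
  by apply: entailed_sym; apply: can_rewrite_entailed ll' => //; case: lr.
- move=> E R s t st [hE hR]; split=> //; apply/entailed_setU1; split=> //.
  exact: headCP_entailed st.
Qed.

Lemma reachable_entailed le c c' :
  reachable canX solveX leT alpha rho le c c' ->
  entailed_config c -> entailed_config c'.
Proof. by elim=> [? ? /step_entailed| |? ? ? _ IH _ IH' /IH/IH']. Qed.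

End Theory.
End Abstraction.

Theorem theorem5p2
  (S : signature) (V : eqType)
  (X : set (equation S V))
  (canX : term S V -> term S V)
  (solveX : equation S V -> option (seq (V * term S V)))
  (leT : rel (term S V))
  (alpha : term S V -> V) (rho : V -> term S V)
  (le : term S V -> term S V -> Prop)
  (E0 : set (equation S V))
  (hX : is_axiomatization X)
  (hcanX : is_canonizer X canX)
  (hsolveX : is_solver X solveX)
  (hleT : total_ordering leT)
  (halpha : is_abstraction alpha rho)
  (hle : total_ground_AC_reduction_ordering le)
  (hcompat : locally_compatible canX solveX leT alpha rho le)
  (hE0 : ground_canonized_equations canX leT alpha rho E0)
  (En : set (equation S V)) (Rn : set (term S V * term S V))
  (hreach : reachable canX solveX leT alpha rho le
              (Config E0 set0) (Config En Rn))
  (s t : term S V) :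
  En (s ≈ t) \/ Rn (s, t) -> eqth (AC_axioms `|` X) E0 s t.
Proof.
have init : entailed_config X E0 (Config E0 set0).
  split=> // a b E0ab; have [a' [b' [ga gb _ _ eab]]] := hE0 _ E0ab.
  (* The pair supplied by [hE0] may list the two sides in the other order. *)
  have gab : ground a /\ ground b by case: (mk_equation_inj eab) => [] [-> ->].
  by case: gab => ? ?; split=> //; apply: eqth_hyp.
have [hE hR] := reachable_entailed halpha hcanX hsolveX hreach init.
by case=> [/hE|/hR] [].
Qed.
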